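(* Let $C_1,\ldots,C_N\subset\mathbb{R}^d$ be closed convex sets with nonempty intersection $C=C_1\cap\cdots\cap C_N$. Let $(\beta^{(n)})_{n\ge1}$ be a sequence in $\mathcal{B}$, $\beta^{(n)}=(\beta^{(n)}_1,\ldots,\beta^{(n)}_N)$, and let $I^{(n)}=\{i:1\le i\le N,\ \beta^{(n)}_i>0\}$ be the set of active indices for $\beta^{(n)}$. Assume that every index $i\in\{1,2,\ldots,N\}$ occurs in $I^{(n)}$ for infinitely many $n$. Let $0\le n_0<n_1<n_2<\cdots$ be integers such that for every $k\ge1$ $$\{1,2,\ldots,N\}\subset I^{(n_{k-1}+1)}\cup I^{(n_{k-1}+2)}\cup\cdots\cup I^{(n_k)},$$ i.e. every index occurs at least once for $n$ such that $n_{k-1}<n\le n_k$. For $n\ge1$ and $i\in I^{(n)}$ put $$\nu_i^{(n)}=\frac{2\beta_i^{(n)}\left(2-\sum_{l=1}^N\beta_l^{(n)}\right)}{\beta_i^{(n)}+2-\sum_{l=1}^N\beta_l^{(n)}},$$ and for $k\ge1$ let $$\nu^{(k)}=\min\{\nu_i^{(n)} : n_{k-1}<n\le n_k,\ i\in I^{(n)}\}.$$ Assume that $$\sum_{k=1}^\infty\nu^{(k)}=+\infty.$$ Then for any $x^{(0)}\in\mathbb{R}^d$ the sequence $x^{(n)}$ defined by $$x^{(n)}=Q_{\beta^{(n)}}(x^{(n-1)}),\qquad n\ge1,$$ is convergent to a point in $C$.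
   Context: For a nonempty closed convex set $D\subset\mathbb{R}^d$ (with Euclidean norm), $P_D$ is the (nearest point) projection onto $D$. The parameter set is $\mathcal{B}=\{\beta=(\beta_1,\ldots,\beta_N): \beta_i\ge 0 \text{ for all } i,\ \sum_{i=1}^N\beta_i\le 2\}$. For $\beta\in\mathcal{B}$ the operator $Q_\beta:\mathbb{R}^d\to\mathbb{R}^d$ is $Q_\beta=\mathrm{Id}-\sum_{j=1}^N\beta_j(\mathrm{Id}-P_{C_j})$, where $\mathrm{Id}$ is the identity. *)

(* Defs.v *)
From HB Require Import structures.
From mathcomp Require Import all_boot all_order all_algebra.
From mathcomp Require Import all_classical all_reals all_analysis.

Set Implicit Arguments.
Unset Strict Implicit.
Unset Printing Implicit Defensive.

Import Order.TTheory GRing.Theory Num.Theory.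
Import numFieldNormedType.Exports.

Local Open Scope classical_set_scope.
Local Open Scope ring_scope.

(* The library norm `|v| on 'rV[R]_d is the sup norm, which would give a
   different notion of nearest point; it induces the same topology. *)
Definition enorm (R : realType) (d : nat) (v : 'rV[R]_d) : R :=
  Num.sqrt (\sum_(i < d) v ord0 i ^+ 2).

Definition nearest (R : realType) (d : nat) (D : set 'rV[R]_d)
    (x : 'rV[R]_d) : set 'rV[R]_d :=
  [set y | D y /\ forall z, D z -> enorm (x - y) <= enorm (x - z)].

(* For D nonempty, closed and convex the nearest point exists and is unique,
   so the default value 0 is never used. *)
Definition proj (R : realType) (d : nat) (D : set 'rV[R]_d)
    (x : 'rV[R]_d) : 'rV[R]_d :=
  xget 0 (nearest D x).

Definition paramB (R : realType) (N : nat) : set ('I_N -> R) :=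
  [set b | (forall i, 0 <= b i) /\ \sum_i b i <= 2].

Definition Qop (R : realType) (d N : nat) (C : 'I_N -> set 'rV[R]_d)
    (b : 'I_N -> R) (x : 'rV[R]_d) : 'rV[R]_d :=
  x - \sum_j b j *: (x - proj (C j) x).

Definition active (R : realType) (N : nat) (b : 'I_N -> R) : {set 'I_N} :=
  [set i | 0 < b i]%SET.

Definition nu (R : realType) (N : nat) (b : 'I_N -> R) (i : 'I_N) : R :=
  (2 * b i * (2 - \sum_l b l)) / (b i + 2 - \sum_l b l).

(* The minimum of nu (beta n) i over m < n <= p and i active for beta n.  It is
   taken in \bar R only so that the neutral element +oo of min can serve as the
   start value: whenever some index is active in the block, the value is the
   usual (finite) minimum. *)
Definition nu_min (R : realType) (N : nat) (beta : nat -> 'I_N -> R)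
    (m p : nat) : \bar R :=
  \big[Order.min/+oo%E]_(m.+1 <= n < p.+1)
    \big[Order.min/+oo%E]_(i in active (beta n)) (nu (beta n) i)%:E.

(* Main.v *)
(* Write u_i = x - P_i x.  Firm nonexpansiveness of the projections gives, for
   every z in the active sets and every active index i,
     |Q x - z|^2 <= |x - z|^2 - nu_i |u_i|^2,
   so the iterates are Fejer monotone.  Summing over blocks, divergence of the
   sum of the nu^(k) yields blocks in which the residuals u_i of all active
   indices are arbitrarily small.  Let y be a cluster point of the starting
   points of such blocks, and consider a block with small residuals starting
   close to y.  At the first n in it for which some set C_i missing y is active,
   only sets containing y have been used so far, so x^(n-1) is still close to y
   by Fejer monotonicity, hence far from C_i: this contradicts the smallness of
   the residual.  As every index is active in the block, y is in C, and Fejer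
   monotonicity with respect to y gives convergence of the whole sequence. *)
Require Import Defs.
From HB Require Import structures.
From mathcomp Require Import all_boot all_order all_algebra.
From mathcomp Require Import all_classical all_reals all_analysis.
From mathcomp Require Import ring lra.
Import Order.TTheory GRing.Theory Num.Theory.
Import numFieldNormedType.Exports.
Local Open Scope classical_set_scope.
Local Open Scope ring_scope.
Set Implicit Arguments.
Unset Strict Implicit.
Unset Printing Implicit Defensive.

(* MathComp-Analysis also has a [proj]. *)
Local Notation proj := Defs.proj.

(** * Euclidean inner product and compactness of its balls *)

Definition dot {R : realType} {d : nat} (u v : 'rV[R]_d) : R :=
  \sum_(i < d) u ord0 i * v ord0 i.

Section Dot.
Context {R : realType} {d : nat}.
Implicit Types u v w : 'rV[R]_d.

Lemma dotC u v : dot u v = dot v u.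
Proof. by apply: eq_bigr => i _; rewrite mulrC. Qed.

Lemma dotDl u v w : dot (u + v) w = dot u w + dot v w.
Proof. by rewrite -big_split; apply: eq_bigr => i _; rewrite mxE mulrDl. Qed.

Lemma dotZl a u v : dot (a *: u) v = a * dot u v.
Proof. by rewrite big_distrr; apply: eq_bigr => i _; rewrite mxE -mulrA. Qed.

Lemma dotNl u v : dot (- u) v = - dot u v.
Proof. by rewrite -scaleN1r dotZl mulN1r. Qed.

Lemma dotDr u v w : dot u (v + w) = dot u v + dot u w.
Proof. by rewrite !(dotC u) dotDl. Qed.

Lemma dotZr a u v : dot u (a *: v) = a * dot u v.
Proof. by rewrite !(dotC u) dotZl. Qed.

Lemma dotNr u v : dot u (- v) = - dot u v.
Proof. by rewrite !(dotC u) dotNl. Qed.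

Lemma dot0l v : dot 0 v = 0.
Proof. by rewrite -(scale0r v) dotZl mul0r. Qed.

Lemma dot_suml (I : finType) (P : pred I) (F : I -> 'rV[R]_d) v :
  dot (\sum_(i | P i) F i) v = \sum_(i | P i) dot (F i) v.
Proof.
apply: (big_morph (dot^~ v)) => [u w|]; first exact: dotDl.
by rewrite /dot big1// => i _; rewrite mxE mul0r.
Qed.

Definition dotE := (dotDl, dotDr, dotNl, dotNr, dotZl, dotZr).

Lemma dot_ge0 u : 0 <= dot u u.
Proof. by apply: sumr_ge0 => i _; rewrite -expr2 sqr_ge0. Qed.

Lemma dotD_le u v : dot (u + v) (u + v) <= 2 * dot u u + 2 * dot v v.
Proof. by have := dot_ge0 (u - v); rewrite !dotE (dotC v u); lra. Qed.

Lemma dot_distC u v : dot (u - v) (u - v) = dot (v - u) (v - u).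
Proof. by rewrite -opprB dotNl dotNr opprK. Qed.

Lemma enorm_le u v : (enorm u <= enorm v) = (dot u u <= dot v v).
Proof. by rewrite /enorm ler_sqrt ?dot_ge0. Qed.

(** The sup norm is attained at one coordinate, whose square is a term of the sum. This carries
    Euclidean bounds over to the library topology. *)
Lemma norm_sq_le_dot u : `|u| ^+ 2 <= dot u u.
Proof.
have [->|u0] := eqVneq `|u| 0; first by rewrite expr0n dot_ge0.
have [[i j] /= e] := mx_norm_neq0 u0.
have -> : `|u| = `|u i j| by exact: e.
rewrite real_normK ?num_real// ord1 /dot (bigD1 j)//= -expr2 lerDl.
by apply: sumr_ge0 => k _; rewrite -expr2 sqr_ge0.
Qed.

Lemma dot_eq0 u : dot u u <= 0 -> u = 0.
Proof.
move=> u0; apply/eqP; rewrite -normr_eq0 -sqrf_eq0 eq_le sqr_ge0 andbT.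
exact: le_trans (norm_sq_le_dot u) u0.
Qed.

Lemma dot_dist_continuous x :
  continuous (fun y : 'rV[R]_d => dot (x - y) (x - y)).
Proof.
apply: continuous_big => [y|i _ y].
  by apply: cvgD; [exact: cvg_fst|exact: cvg_snd].
have c : (fun y : 'rV[R]_d => (x - y) ord0 i) @ y --> (x - y) ord0 i.
  rewrite !mxE; under eq_fun do rewrite !mxE.
  exact: (@cvgB _ _ _ _ _ _ (fun y : 'rV[R]_d => y ord0 i) _ _
    (cvg_cst _) (@coord_continuous _ _ _ _ _ y)).
exact: (cvgM c c).
Qed.

Lemma bounded_dot_ball x r :
  bounded_set [set y : 'rV[R]_d | dot (x - y) (x - y) <= r].
Proof.
exists (2 * `|x| + 1 + `|r|); split => // M ltM y /= yr.
apply: le_trans (ltW ltM).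
have nxy : `|x - y| <= 1 + `|r|.
  have := le_trans (norm_sq_le_dot (x - y)) yr.
  have := ler_norm r; have := normr_ge0 (x - y); have := normr_ge0 r.
  by nra.
have -> : y = x - (x - y) by rewrite opprB addrC subrK.
apply: le_trans (ler_normB _ _) _.
have := normr_ge0 x; lra.
Qed.

Lemma compact_dot_ball x r :
  compact [set y : 'rV[R]_d | dot (x - y) (x - y) <= r].
Proof.
apply: bounded_closed_compact; first exact: bounded_dot_ball.
apply: (@preimage_closed _ _ (fun y : 'rV_d => dot (x - y) (x - y))
  [set z | z <= r]).
  by move=> y _; exact: dot_dist_continuous.
exact: closed_le.
Qed.

End Dot.

(** * Nearest point projections *)

Local Notation sqdist D x := (dot (x - proj D x) (x - proj D x)).

Section Projection.
Context {R : realType} {d : nat} {D : set 'rV[R]_d}.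
Hypotheses (D_closed : closed D) (D0 : D !=set0).
Implicit Types x z : 'rV[R]_d.

(** Existence by compactness: the distance is minimised over [D] cut by the ball around [x] through
    some [z0] in [D]; points outside that ball are farther than [z0]. *)
Lemma nearest_proj x : nearest D x (proj D x).
Proof.
have [z0 Dz0] := D0; apply: xgetPex.
pose A := D `&` [set y | dot (x - y) (x - y) <= dot (x - z0) (x - z0)].
have [||y|y] := @compact_EVT_min _ R (fun y : 'rV_d => dot (x - y) (x - y)) A.
- by exists z0; split => /=.
- by rewrite /A setIC; apply: compact_closedI => //; exact: compact_dot_ball.
- by apply: continuous_subspaceT; exact: dot_dist_continuous.
rewrite inE => -[Dy _] miny; exists y; split => // z Dz; rewrite enorm_le.
have [le_z0|lt_z0] := leP (dot (x - z) (x - z)) (dot (x - z0) (x - z0)).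
  by apply: miny; rewrite inE.
by apply: le_trans (ltW lt_z0); apply: miny; rewrite inE; split => /=.
Qed.

Lemma proj_in x : D (proj D x).
Proof. by have [] := nearest_proj x. Qed.

Lemma proj_le x z : D z ->
  sqdist D x <= dot (x - z) (x - z).
Proof. by move=> Dz; rewrite -enorm_le; have [_ ->] := nearest_proj x. Qed.

Hypothesis D_convex : convex_set D.

Lemma convex_set_segment z1 z2 t : D z1 -> D z2 -> 0 <= t -> t <= 1 ->
  D (z1 + t *: (z2 - z1)).
Proof.
move=> Dz1 Dz2 t0 t1.
have := @D_convex z2 z1 (Itv01 t0 t1) (mem_set Dz2) (mem_set Dz1).
rewrite inE; congr D.
rewrite /conv /= /convex.conv /= /unstable.onem scalerBl scale1r scalerBr.
by rewrite addrCA.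
Qed.

Lemma proj_firm x z : D z ->
  sqdist D x <= dot (x - proj D x) (x - z).
Proof.
move=> Dz; set p := proj D x.
suff : dot (x - p) (z - p) <= 0 by rewrite !dotE; lra.
rewrite leNgt; apply/negP => a0.
set a := dot (x - p) (z - p) in a0; set b := dot (z - p) (z - p).
have b0 : 0 <= b by exact: dot_ge0.
have ab0 : 0 < a + b by lra.
(* With this [t] in (0,1], [t * b <= a]; so moving from [p] towards [z] by [t] lowers the squared
   distance by [t * (2 * a - t * b) > 0], against minimality of [p]. *)
pose t := a / (a + b).
have tab : t * (a + b) = a by rewrite /t mulfVK ?gt_eqF.
have t0 : 0 < t by rewrite divr_gt0.
have t1 : t <= 1 by rewrite ler_pdivrMr//; lra.
have := proj_le x (convex_set_segment (proj_in x) Dz (ltW t0) t1).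
rewrite -/p opprD addrA.
have -> : dot (x - p - t *: (z - p)) (x - p - t *: (z - p)) =
    dot (x - p) (x - p) - t * (2 * a - t * b).
  rewrite /a /b; move: (x - p) (z - p) => u v.
  by rewrite !dotE (dotC v u); ring.
have : 0 < t * (2 * a - t * b) by apply: mulr_gt0 => //; nra.
lra.
Qed.

End Projection.

(** * Descent of one operator step *)

Section Operator.
Context {R : realType} {d N : nat}.
Implicit Types (b : 'I_N -> R) (u : 'I_N -> 'rV[R]_d) (v w x z : 'rV[R]_d).

Lemma weighted_variance_ge0 b u v (P : pred 'I_N) : (forall i, 0 <= b i) ->
  0 <= \sum_(j | P j) b j * dot (u j) (u j)
       - 2 * dot (\sum_(j | P j) b j *: u j) v + (\sum_(j | P j) b j) * dot v v.
Proof.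
move=> b0.
have -> : \sum_(j | P j) b j * dot (u j) (u j)
      - 2 * dot (\sum_(j | P j) b j *: u j) v + (\sum_(j | P j) b j) * dot v v
    = \sum_(j | P j) b j * dot (u j - v) (u j - v).
  rewrite dot_suml mulr_suml mulr_sumr -sumrN -!big_split /=.
  by apply: eq_bigr => j _; rewrite !dotE (dotC v); ring.
by apply: sumr_ge0 => j _; rewrite mulr_ge0 ?dot_ge0.
Qed.

(** The variance about [w / 2] gives [S >= (1 - s / 4) * dot w w], and [s <= 2]. *)
Lemma sum_weights_sq b u (w := \sum_j b j *: u j) : paramB b ->
  dot w w <= 2 * \sum_j b j * dot (u j) (u j).
Proof.
move=> [b0 b2].
have := weighted_variance_ge0 u (2^-1 *: w) predT b0.
rewrite -/w !dotZr dotZl.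
set S := \sum_j b j * _; set s := \sum_j b j in b2 *.
have := dot_ge0 w; nra.
Qed.

(* [nu b i] is the best constant here: given [u i], the right-hand side is
   smallest when all other [u j] are equal to [w / 2], which is the centre
   at which the variance of the [u j] is taken. *)
Lemma nu_sq_le b u i (w := \sum_j b j *: u j) : paramB b -> 0 < b i ->
  nu b i * dot (u i) (u i) <= 2 * (\sum_j b j * dot (u j) (u j)) - dot w w.
Proof.
move=> [b0 b2] bi.
have := weighted_variance_ge0 u (2^-1 *: w) (predC1 i) b0.
rewrite dotZr [dot (2^-1 *: w) _]dotZr dotZl.
have -> : \sum_(j | predC1 i j) b j *: u j = w - b i *: u i.
  by rewrite /w [in RHS](bigD1 i)//= addrAC subrr add0r.
have eS : \sum_j b j * dot (u j) (u j) =
    b i * dot (u i) (u i) + \sum_(j | predC1 i j) b j * dot (u j) (u j).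
  by rewrite (bigD1 i).
have es : \sum_j b j = b i + \sum_(j | predC1 i j) b j by rewrite (bigD1 i).
rewrite /nu eS.
set T := \sum_(j | predC1 i j) b j * _; set S := \sum_j b j in b2 es *.
set s := \sum_(j | predC1 i j) b j in es *.
have tau0 : 0 < b i + 2 - S by lra.
(* After clearing the denominator [b i + 2 - S], the claim is twice the variance bound plus half of
   this square. *)
have := dot_ge0 ((b i + 2 - S) *: w - (2 * b i) *: u i).
rewrite mulrAC ler_pdivrMr// !dotE (dotC w (u i)).
move: (dot w w) (dot (u i) w) (dot (u i) (u i)) => W p U sq var.
have {}var : 0 <= (b i + 2 - S) *
    (T - 2 * (2^-1 * (W - b i * p)) + s * (2^-1 * (2^-1 * W))).
  by apply: mulr_ge0 => //; exact: ltW.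
rewrite (_ : s = S - b i) in var; last by rewrite es addrC addKr.
move: var sq; lra.
Qed.

Lemma nu_ge0 b i : paramB b -> 0 < b i -> 0 <= nu b i.
Proof.
move=> [b0 b2] bi; rewrite /nu divr_ge0//; last lra.
by rewrite mulr_ge0 ?mulr_ge0 ?(ltW bi)//; lra.
Qed.

Context {C : 'I_N -> set 'rV[R]_d}.
Hypotheses (C_closed : forall i, closed (C i)).
Hypotheses (C_convex : forall i, convex_set (C i)).

(** Expand the square of [(x - z) - w]: firm nonexpansiveness bounds the cross term index by index,
    and inactive indices have weight zero. *)
Lemma Qop_sq_le b x z : paramB b -> (forall j, 0 < b j -> C j z) ->
  dot (Qop C b x - z) (Qop C b x - z) <= dot (x - z) (x - z)
    - (2 * (\sum_j b j * sqdist (C j) x)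
       - dot (\sum_j b j *: (x - proj (C j) x))
             (\sum_j b j *: (x - proj (C j) x))).
Proof.
move=> [b0 _] Cz; rewrite /Qop; set w := \sum_j _ *: _.
suff : \sum_j b j * sqdist (C j) x <= dot w (x - z).
  rewrite addrAC; move: (\sum_j _) (x - z) => S v.
  by rewrite !dotE (dotC v w); lra.
rewrite dot_suml; apply: ler_sum => j _; rewrite dotZl.
have := b0 j; rewrite le_eqVlt => /predU1P[<-|bj]; first by rewrite !mul0r.
by rewrite ler_pM2l//; apply: proj_firm => //; [exists z|]; exact: Cz.
Qed.

Lemma Qop_fejer b x z : paramB b -> (forall j, 0 < b j -> C j z) ->
  dot (Qop C b x - z) (Qop C b x - z) <= dot (x - z) (x - z).
Proof.
move=> Bb Cz; have := Qop_sq_le x Bb Cz.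
have := sum_weights_sq (fun j => x - proj (C j) x) Bb; lra.
Qed.

Lemma Qop_descent b x z i :
    paramB b -> (forall j, 0 < b j -> C j z) -> 0 < b i ->
  nu b i * sqdist (C i) x <=
    dot (x - z) (x - z) - dot (Qop C b x - z) (Qop C b x - z).
Proof.
move=> Bb Cz bi; have := Qop_sq_le x Bb Cz.
have := nu_sq_le (fun j => x - proj (C j) x) Bb bi; lra.
Qed.

End Operator.

(** * Block minima of the descent constants *)

Section NuMin.
Context {R : realType} {N : nat} (beta : nat -> 'I_N -> R).
Hypothesis beta_B : forall n, (1 <= n)%N -> paramB (beta n).

Lemma nu_min_ge0 m p : (0 <= nu_min beta m p)%E.
Proof.
rewrite /nu_min big_seq; apply: (big_ind (fun e => 0 <= e)%E) => [|e f e0 f0|n].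
- by rewrite leey.
- by rewrite le_min e0.
rewrite mem_index_iota => /andP[mn _].
apply: (big_ind (fun e => 0 <= e)%E) => [|e f e0 f0|i]; first by rewrite leey.
  by rewrite le_min e0.
rewrite inE => bi; rewrite lee_fin nu_ge0//; apply: beta_B.
exact: leq_ltn_trans mn.
Qed.

Lemma nu_min_le m p n i : (m < n <= p)%N -> i \in active (beta n) ->
  (nu_min beta m p <= (nu (beta n) i)%:E)%E.
Proof.
move=> mnp ai; rewrite /nu_min (bigD1_seq n)/= ?iota_uniq//; last first.
  by rewrite mem_index_iota.
by rewrite ge_min (bigD1 i)//= ge_min lexx.
Qed.

End NuMin.


(** * Fejer monotonicity, blocks with small residuals, and the cluster point *)

Section Sequence.
Context {R : realType} {d N : nat} {C : 'I_N -> set 'rV[R]_d}.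
Hypotheses (C_closed : forall i, closed (C i)).
Hypotheses (C_convex : forall i, convex_set (C i)).
Context {beta : nat -> 'I_N -> R} {x : nat -> 'rV[R]_d}.
Hypothesis beta_B : forall n, (1 <= n)%N -> paramB (beta n).
Hypothesis x_rec : forall n, (1 <= n)%N -> x n = Qop C (beta n) (x n.-1).

(** Restricting to the sets active between [m] and [p] makes this applicable to a cluster point not
    yet known to lie in every set. *)
Lemma iterates_fejer z m p : (m <= p)%N ->
    (forall n j, (m < n <= p)%N -> j \in active (beta n) -> C j z) ->
  dot (x p - z) (x p - z) <= dot (x m - z) (x m - z).
Proof.
elim: p => [|p IHp]; first by rewrite leqn0 => /eqP ->.
rewrite leq_eqVlt => /predU1P[->//|]; rewrite ltnS => mp Cz.
rewrite x_rec//= ; apply: le_trans (IHp mp _).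
  apply: (Qop_fejer C_closed C_convex) => [|j bj]; first exact: beta_B.
  by apply: (Cz p.+1); rewrite ?ltnS ?mp ?leqnn// inE.
by move=> n j /andP[mn np]; apply: Cz; rewrite mn leqW.
Qed.

Lemma block_index_near y m p e : (m <= p)%N ->
    (forall n i, (m < n <= p)%N -> i \in active (beta n) ->
      sqdist (C i) (x n.-1) <= e) ->
    dot (x m - y) (x m - y) <= e ->
    (forall i, C i !=set0) ->
    (forall i, ~ C i y -> 4 * e < sqdist (C i) y) ->
  forall n i, (m < n <= p)%N -> i \in active (beta n) -> C i y.
Proof.
move=> mp small near C0 gap n.
elim/ltn_ind: n => n IHn i /[dup] mnp /andP[mn np] ai.
apply: contrapT => nCiy; have := gap i nCiy; apply/negP; rewrite -leNgt.
have n1 : (m <= n.-1)%N by rewrite -ltnS prednK// (leq_ltn_trans _ mn).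
have nn1 : (n.-1 < n)%N by rewrite prednK// (leq_ltn_trans _ mn).
(* By induction every set active in the block before [n] contains [y], so the iterates up to [n.-1]
   stay near [y]. *)
have xy : dot (x n.-1 - y) (x n.-1 - y) <= e.
  apply: le_trans near; apply: iterates_fejer => // n' j /andP[mn' n'n].
  apply: IHn; first exact: leq_ltn_trans nn1.
  by rewrite mn' (leq_trans n'n)// (leq_trans (ltnW nn1)).
have Pi := proj_in (@C_closed i) (C0 i) (x n.-1).
apply: le_trans (proj_le (@C_closed i) (C0 i) y Pi) _.
have -> : y - proj (C i) (x n.-1) =
    (y - x n.-1) + (x n.-1 - proj (C i) (x n.-1)).
  by rewrite addrA subrK.
(* Two squared distances of at most [e], each doubled: hence the 4 in the gap hypothesis. *)
apply: le_trans (dotD_le _ _) _.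
rewrite (dot_distC y); have := small n i mnp ai; lra.
Qed.

Context {nn : nat -> nat}.
Hypothesis nn_incr : forall k, (nn k < nn k.+1)%N.
Hypothesis nu_div : (\sum_(1 <= k <oo) nu_min beta (nn k.-1) (nn k))%E = +oo%E.

(** Otherwise each block has a residual above [e], so [nu_min] times [e] is at most the decrease of
    [a] over the block; telescoping bounds the divergent series by [a 0 / e]. *)
Lemma small_residual_block z e : (forall i, C i z) -> 0 < e ->
  exists2 k, (1 <= k)%N & forall n i, (nn k.-1 < n <= nn k)%N ->
    i \in active (beta n) ->
    sqdist (C i) (x n.-1) <= e.
Proof.
move=> Cz e0; apply: contrapT => nsmall.
pose a k := dot (x (nn k) - z) (x (nn k) - z).
have nu_a k : (1 <= k)%N ->
    (nu_min beta (nn k.-1) (nn k) <= ((a k.-1 - a k) / e)%:E)%E.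
  move=> k1.
  have [n [i [/[dup] knk /andP[kn nk] ai big]]] : exists n i,
      [/\ (nn k.-1 < n <= nn k)%N, i \in active (beta n) &
      e < sqdist (C i) (x n.-1)].
    apply: contrapT => nbig; apply: nsmall; exists k => // n i knk ai.
    by rewrite leNgt; apply/negP => ?; apply: nbig; exists n, i.
  have n1 : (1 <= n)%N by exact: leq_ltn_trans kn.
  have bi : 0 < beta n i by move: ai; rewrite inE.
  apply: le_trans (nu_min_le knk ai) _.
  rewrite lee_fin ler_pdivlMr//.
  have nu0 := nu_ge0 (beta_B n1) bi.
  apply: le_trans (ler_wpM2l nu0 (ltW big)) _.
  apply: le_trans (Qop_descent C_closed C_convex _ (beta_B n1)
    (fun j _ => Cz j) bi) _.
  (* The decrease at step [n] is at most that over its whole block, by monotonicity before and after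
     [n]. *)
  rewrite -x_rec//; apply: lerB; apply: iterates_fejer => //.
  by rewrite -ltnS prednK.
have: (\sum_(1 <= k <oo) nu_min beta (nn k.-1) (nn k) <= (a 0%N / e)%:E)%E.
  apply: lime_le.
    by apply: is_cvg_nneseries => k _ _; exact: nu_min_ge0.
  near=> M.
  have M1 : (1 <= M)%N by near: M; exact: nbhs_infty_ge.
  apply: (@le_trans _ _ ((\sum_(1 <= k < M) (a k.-1 - a k) / e)%:E)).
    rewrite -sumEFin big_seq [leRHS]big_seq; apply: lee_sum => k.
    by rewrite mem_index_iota => /andP[/nu_a].
  rewrite lee_fin -mulr_suml ler_pM2r ?invr_gt0//.
  have -> : \sum_(1 <= k < M) (a k.-1 - a k) = a 0%N - a M.-1.
    rewrite big_add1 /= -[RHS]opprB -telescope_sumr// -sumrN.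
    by apply: eq_bigr => k _; rewrite opprB.
  by rewrite gerBl dot_ge0.
by rewrite nu_div leye_eq.
Unshelve. all: by end_near. Qed.

Hypothesis nn_cover : forall k, (1 <= k)%N -> forall i : 'I_N,
  exists n, (nn k.-1 < n <= nn k)%N /\ i \in active (beta n).

Lemma fejer_cluster_common z : (forall i, C i z) ->
  exists2 y, (forall i, C i y) &
    forall e, 0 < e -> exists n, dot (x n - y) (x n - y) <= e.
Proof.
move=> Cz.
have [k kP] : {k : nat -> nat & forall j, (1 <= k j)%N /\ forall n i,
    (nn (k j).-1 < n <= nn (k j))%N -> i \in active (beta n) ->
    sqdist (C i) (x n.-1) <= j.+1%:R^-1}.
  apply: (@choice _ _ (fun j k => (1 <= k)%N /\ forall n i,
    (nn k.-1 < n <= nn k)%N -> i \in active (beta n) ->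
    sqdist (C i) (x n.-1) <= j.+1%:R^-1)) => j.
  have [|k k1 kP] := small_residual_block Cz (_ : 0 < j.+1%:R^-1).
    by rewrite invr_gt0.
  by exists k.
pose w j := x (nn (k j).-1).
pose A := [set y : 'rV[R]_d | dot (z - y) (z - y) <=
  dot (x 0%N - z) (x 0%N - z)].
have wA : \forall j \near \oo, A (w j).
  apply: nearW => j; rewrite /A/= (dot_distC z).
  by apply: (iterates_fejer (leq0n _)) => *; exact: Cz.
have [y [_ cly]] := @compact_dot_ball _ _ z _ (w @ \oo) _ wA.
(* Clustering is used along tails: [j] can be taken arbitrarily late, which also makes the residual
   bound [1 / (j + 1)] small. *)
have near_w e J : 0 < e -> exists2 j, (J <= j)%N & dot (w j - y) (w j - y) <= e.
  move=> e0.
  have [||_ [[j /= Jj <-] /= ?]] := cly (w @` [set j | J <= j]%N)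
      [set v | dot (v - y) (v - y) <= e].
  - by exists J => // j Jj; exists j.
  - have /cvgrPdist_le/(_ _ e0) : dot (y - v) (y - v) @[v --> y] -->
      dot (y - y) (y - y) by exact: dot_dist_continuous.
    apply: filterS => v; rewrite subrr dot0l sub0r normrN dot_distC.
    exact: le_trans (ler_norm _).
  - by exists j.
exists y; last first.
  by move=> e e0; have [j _ ?] := near_w e 0%N e0; exists (nn (k j).-1).
have C0 i : C i !=set0 by exists z.
have g0 i : ~ C i y -> 0 < sqdist (C i) y.
  move=> nCy; rewrite ltNge; apply/negP => /dot_eq0 /eqP; rewrite subr_eq0.
  by move=> /eqP yP; apply: nCy; rewrite yP; exact: proj_in.
(* Dividing by 5 makes the gap [4 * e] strict; the start value 1 keeps [e] positive when no set
   misses [y]. *)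
pose e := \big[Order.min/1]_(i | ~~ `[< C i y >]) sqdist (C i) y / 5.
have e0 : 0 < e.
  rewrite divr_gt0//; apply: (big_ind (fun r => 0 < r)) => // [r s r0 s0|i].
    by rewrite lt_min r0.
  by move/asboolPn; exact: g0.
have gap i : ~ C i y -> 4 * e < sqdist (C i) y.
  move=> nCy; have := g0 i nCy.
  have : e * 5 <= sqdist (C i) y.
    rewrite /e mulfVK// (bigD1 i)/= ?ge_min ?lexx//; exact/asboolPn.
  lra.
have [J _ eJ] := near_infty_natSinv_lt (PosNum e0).
have [j Jj wj] := near_w e J e0.
have [k1 small] := kP j.
move=> i; have [n [kn ai]] := nn_cover k1 i.
apply: (block_index_near (m := nn (k j).-1) (p := nn (k j)) (e := e))
  kn ai => //.
  by rewrite -[in leqRHS](prednK k1) ltnW.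
move=> n' i' kn' ai'; apply: le_trans (small n' i' kn' ai') _.
exact: ltW (eJ j Jj).
Unshelve. all: by end_near. Qed.

End Sequence.

Theorem theorem2 (R : realType) (d N : nat) (hN : (0 < N)%N)
    (C : 'I_N -> set 'rV[R]_d)
    (C_closed : forall i, closed (C i))
    (C_convex : forall i, convex_set (C i))
    (C_nonempty : (\bigcap_i C i) !=set0)
    (beta : nat -> 'I_N -> R)
    (beta_B : forall n, (1 <= n)%N -> paramB (beta n))
    (inf_often : forall (i : 'I_N) (m : nat),
      exists n, (m < n)%N /\ i \in active (beta n))
    (nn : nat -> nat)
    (nn_incr : forall k, (nn k < nn k.+1)%N)
    (nn_cover : forall k, (1 <= k)%N -> forall i : 'I_N,
      exists n, (nn k.-1 < n <= nn k)%N /\ i \in active (beta n))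
    (nu_div : (\sum_(1 <= k <oo) nu_min beta (nn k.-1) (nn k))%E = +oo%E)
    (x : nat -> 'rV[R]_d)
    (x_rec : forall n, (1 <= n)%N -> x n = Qop C (beta n) (x n.-1)) :
  exists c, (\bigcap_i C i) c /\ x n @[n --> \oo] --> c.
Proof.
have [z Cz] := C_nonempty.
have [y Cy near_y] := fejer_cluster_common C_closed C_convex beta_B x_rec
  nn_incr nu_div nn_cover (fun i => Cz i I).
exists y; split; first by move=> i _; exact: Cy.
apply/cvgrPdist_le => /= e e0.
(* One iterate within Euclidean distance [e] of [y] suffices, since [y] lies in all sets and later
   iterates come no farther from it. *)
have [m xm] := near_y (e ^+ 2) (exprn_gt0 _ e0).
near=> n.
have mn : (m <= n)%N by near: n; exact: nbhs_infty_ge.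
rewrite -(@ler_sqr _ `|y - x n| e) ?nnegrE ?(ltW e0)// distrC.
apply: le_trans (norm_sq_le_dot _) (le_trans _ xm).
exact: (iterates_fejer C_closed C_convex beta_B x_rec).
Unshelve. all: by end_near. Qed.
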